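(* For any $p\in(0;1]$, the function $S_p(x)=\sum_{k=0}^{\infty}\left(\frac{T_0(2^k x)}{2^k}\right)^p$ satisfies the generalized Hölder condition with the exponent $p$ and the constant $$C=\frac1p\cdot\log_2\left(\frac{p\cdot\ln 2}{2^p-1}\right)+\frac{2^p}{p\cdot\ln 2}+1,$$ that is, for all distinct $x,y\in\mathbb{R}$ with $|x-y|\le 1/2$, $$|S_p(x)-S_p(y)|\le C\,|x-y|^p\cdot\log_2\frac{1}{|x-y|}.$$
   Context: $T_0(x)$ denotes the distance from the real number $x$ to the nearest integer: $T_0(x)=|x-[x+1/2]|=\min_{m\in\mathbb{Z}}|x-m|$. For real $p>0$, $S_p(x)=\sum_{k=0}^{\infty}\left(\frac{T_0(2^k x)}{2^k}\right)^p$ for $x\in\mathbb{R}$ (a convergent series). A function $f\colon\mathbb{R}\to\mathbb{R}$ satisfies the generalized Hölder condition with the exponent $p$ and with the constant $C$ if for all distinct $x,y\in\mathbb{R}$ such that $|x-y|\le 1/2$ the inequality $|f(x)-f(y)|\le C|x-y|^p\cdot\log_2\frac{1}{|x-y|}$ holds. *)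

(* Defs.v *)
From mathcomp Require Import all_boot all_order all_algebra.
From mathcomp Require Import all_classical all_reals all_analysis.
From mathcomp Require Import lra.

Set Implicit Arguments.
Unset Strict Implicit.
Unset Printing Implicit Defensive.

Import Order.TTheory GRing.Theory Num.Theory.
Import numFieldNormedType.Exports.

Local Open Scope classical_set_scope.
Local Open Scope ring_scope.

Definition log2 {R : realType} (x : R) : R := ln x / ln 2.

(* Distance from x to the nearest integer; see T0_min for the minimum over
   the integers. *)
Definition T0 {R : realType} (x : R) : R :=
  `|x - (Num.floor (x + 2^-1))%:~R|.

(* The k-th term may have base 0; since 0 `^ p = 0 for p != 0, powR agrees there
   with the usual real power of exponent p > 0. *)
Definition Sp_term {R : realType} (p x : R) (k : nat) : R :=
  (T0 (2 ^+ k * x) / 2 ^+ k) `^ p.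

(* For p > 0 the series converges (is_cvg_Sp), so the limit is its sum. *)
Definition Sp {R : realType} (p x : R) : R := limn (series (Sp_term p x)).

Definition generalized_holder {R : realType} (f : R -> R) (p C : R) : Prop :=
  forall x y : R, x != y -> `|x - y| <= 2^-1 ->
    `|f x - f y| <= C * `|x - y| `^ p * log2 (1 / `|x - y|).

Lemma T0_le_half {R : realType} (x : R) : T0 x <= 2^-1.
Proof.
rewrite /T0; have := floor_itv (x + 2^-1); rewrite intrD => /andP[h1 h2].
by rewrite ler_norml; apply/andP; split; lra.
Qed.

Lemma T0_min {R : realType} (x : R) (m : int) : T0 x <= `|x - m%:~R|.
Proof.
have [->|mN] := eqVneq m (Num.floor (x + 2^-1)); first by [].
have d1 : 1 <= `|(Num.floor (x + 2^-1))%:~R - m%:~R| :> R.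
  by rewrite -intrB norm_intr_ge1 ?intr_int// intr_eq0 subr_eq0 eq_sym.
have := T0_le_half x.
have := ler_normD (x - m%:~R) (- (x - (Num.floor (x + 2^-1))%:~R)).
rewrite normrN -/(T0 x).
rewrite (_ : _ + - _ = (Num.floor (x + 2^-1))%:~R - m%:~R); last by lra.
lra.
Qed.

Lemma is_cvg_Sp {R : realType} (p x : R) : 0 < p -> cvgn (series (Sp_term p x)).
Proof.
move=> p0; have q1 : `|2^-1 `^ p| < 1 :> R.
  rewrite ger0_norm ?powR_ge0// /powR invr_eq0 pnatr_eq0 /= expR_lt1.
  by rewrite nmulr_llt0 ?ln_lt0//; lra.
apply: (@series_le_cvg _ _ (geometric 1 (2^-1 `^ p))) => [k|k|k|].
- exact: powR_ge0.
- by rewrite /= mul1r exprn_ge0 ?powR_ge0.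
- rewrite /= mul1r -powR_mulrn ?powR_ge0// powRAC powR_mulrn ?invr_ge0//.
  apply: ge0_ler_powR; rewrite ?nnegrE ?(ltW p0) ?divr_ge0 ?exprn_ge0 //.
  + by rewrite /T0.
  + rewrite exprVn ler_piMl ?invr_ge0 ?exprn_ge0//.
    by apply: le_trans (T0_le_half _) _; rewrite invf_le1// ler1n.
- exact: is_cvg_geometric_series.
Qed.

(* Main.v *)
(* Put h = |x - y|. Since p <= 1 gives |a^p - b^p| <= |a - b|^p, and T0 is
   1-Lipschitz with values in [0, 1/2], the k-th terms of S_p(x) and S_p(y)
   differ by at most min(h^p, 2^(-p(k+1))). Using the first bound for k < n and
   the second for k >= n gives |S_p(x) - S_p(y)| <= n h^p + 2^(-pn) / (2^p - 1).
   With L = log2(1/h) and u = p ln 2, the right-hand side is minimal over real n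
   at n = L + d, where d = log2(u / (e^u - 1)) / p; taking for n the integer
   part of L + d costs a factor 2^p in the second summand and yields the bound
   h^p (L + d + 2^p / u). This suffices because L >= 1 and d + 2^p / u >= 0. *)

Require Import Defs.
From mathcomp Require Import all_boot all_order all_algebra.
From mathcomp Require Import all_classical all_reals all_analysis.
From mathcomp Require Import ring lra.

Import Order.TTheory GRing.Theory Num.Theory.
Import numFieldNormedType.Exports.

Local Open Scope ring_scope.

(** A ratio [r = t / (a + b)] in [[0, 1]] satisfies [r <= r ^ p] because [p <= 1]. Multiplying by
    [(a + b) ^ p] and adding the cases [t = a] and [t = b] gives the claim. *)
Lemma powR_subadditive (R : realType) (p a b : R) : 0 < p -> p <= 1 ->
  0 <= a -> 0 <= b -> (a + b) `^ p <= a `^ p + b `^ p.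
Proof.
move=> p0 p1 a0 b0; have [s0|s0] := leP (a + b) 0.
  have -> : a + b = 0 by lra.
  by rewrite powR0 ?gt_eqF// addr_ge0 ?powR_ge0.
suff ratio_le t : 0 <= t <= a + b -> t / (a + b) * (a + b) `^ p <= t `^ p.
  apply: le_trans (lerD (ratio_le a _) (ratio_le b _)); try lra.
  by rewrite -mulrDl -mulrDl divff ?mul1r// gt_eqF.
move=> /andP[t0 tab]; have [->|tn0] := eqVneq t 0.
  by rewrite !mul0r powR_ge0.
have tp : 0 < t by rewrite lt_def tn0.
rewrite -[X in _ <= X `^ _](@divfK _ (a + b)) ?gt_eqF//.
rewrite powRM ?divr_ge0 ?(ltW s0)//.
rewrite ler_wpM2r ?powR_ge0// ger1_powR// divr_gt0//=.
by rewrite ler_pdivrMr// mul1r.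
Qed.

(** For [b <= a], this is subadditivity applied to [a = (a - b) + b]. *)
Lemma ler_dist_powR (R : realType) (p a b : R) : 0 < p -> p <= 1 ->
  0 <= a -> 0 <= b -> `|a `^ p - b `^ p| <= `|a - b| `^ p.
Proof.
move=> p0 p1; wlog ba : a b / b <= a => [H a0 b0|a0 b0].
  have [/H|/ltW/H] := leP b a; first exact.
  by rewrite distrC (distrC a); apply.
have := powR_subadditive _ p (a - b) b p0 p1.
rewrite subrK subr_ge0 => /(_ ba b0) H.
rewrite (ger0_norm (_ : 0 <= a - b)) ?subr_ge0//.
rewrite ger0_norm ?subr_ge0; first by lra.
by apply: ge0_ler_powR; rewrite ?nnegrE// ltW.
Qed.

Lemma T0_ge0 (R : realType) (x : R) : 0 <= T0 x.
Proof. exact: normr_ge0. Qed.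

Lemma ler_dist_T0 (R : realType) (x y : R) : `|T0 x - T0 y| <= `|x - y|.
Proof.
have T0_le u v : T0 u <= `|u - v| + T0 v :> R.
  (* The integer nearest to [v] is a competitor in the minimum for [u]. *)
  apply: le_trans (T0_min u (Num.floor (v + 2^-1))) _.
  by rewrite (le_trans _ (ler_normD _ _))// addrA subrK.
have := T0_le x y; have := T0_le y x; rewrite (distrC y) => ? ?.
by rewrite ler_norml; apply/andP; split; lra.
Qed.

Lemma ler_dist_T0_half (R : realType) (x y : R) : `|T0 x - T0 y| <= 2^-1.
Proof.
have := T0_ge0 _ x; have := T0_ge0 _ y.
have := T0_le_half x; have := T0_le_half y => ? ? ? ?.
by rewrite ler_norml; apply/andP; split; lra.
Qed.

Lemma ler_dist_Sp_term (R : realType) (p x y : R) (k : nat) :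
    0 < p -> p <= 1 ->
  `|Sp_term p x k - Sp_term p y k| <=
    (`|T0 (2 ^+ k * x) - T0 (2 ^+ k * y)| / 2 ^+ k) `^ p.
Proof.
move=> p0 p1; apply: le_trans (ler_dist_powR _ _ _ _ p0 p1 _ _) _.
- by rewrite divr_ge0 ?exprn_ge0 ?T0_ge0.
- by rewrite divr_ge0 ?exprn_ge0 ?T0_ge0.
by rewrite -mulrBl normrM [`|_^-1|]ger0_norm// invr_ge0 exprn_ge0.
Qed.

Lemma ler_dist_Sp_term_dist (R : realType) (p x y : R) (k : nat) :
    0 < p -> p <= 1 ->
  `|Sp_term p x k - Sp_term p y k| <= `|x - y| `^ p.
Proof.
move=> p0 p1; apply: le_trans (ler_dist_Sp_term _ _ _ _ _ p0 p1) _.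
have k0 : 0 < 2 ^+ k :> R by rewrite exprn_gt0.
apply: ge0_ler_powR; rewrite ?nnegrE ?(ltW p0) ?divr_ge0 ?(ltW k0)//.
rewrite ler_pdivrMr// (le_trans (ler_dist_T0 _ _ _))//.
by rewrite -mulrBr normrM (gtr0_norm k0) mulrC.
Qed.

Lemma ler_dist_Sp_term_geometric (R : realType) (p x y : R) (k : nat) :
    0 < p -> p <= 1 ->
  `|Sp_term p x k - Sp_term p y k| <= (2^-1 `^ p) ^+ k.+1.
Proof.
move=> p0 p1; apply: le_trans (ler_dist_Sp_term _ _ _ _ _ p0 p1) _.
have k0 : 0 < 2 ^+ k :> R by rewrite exprn_gt0.
rewrite -[leRHS]powR_mulrn ?powR_ge0// powRAC powR_mulrn ?invr_ge0//.
apply: ge0_ler_powR; rewrite ?nnegrE ?(ltW p0) ?divr_ge0 ?exprn_ge0//.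
by rewrite exprS exprVn ler_pM2r ?invr_gt0// ler_dist_T0_half.
Qed.

Lemma sum_le_const_geometric (R : realFieldType) (b : nat -> R) (a q : R)
    (n m : nat) : 0 <= q < 1 ->
  (forall k, b k <= a) -> (forall k, b k <= q ^+ k.+1) ->
  \sum_(0 <= k < n + m) b k <= n%:R * a + q ^+ n.+1 / (1 - q).
Proof.
move=> /andP[q0 q1] ba bq.
have q1' : 0 < 1 - q by rewrite subr_gt0.
(* Keeping the exact finite geometric sum lets the induction on [m] close. *)
suff H : \sum_(0 <= k < n + m) b k <=
    n%:R * a + (q ^+ n.+1 - q ^+ (n + m).+1) / (1 - q).
  apply: le_trans H _; rewrite lerD2l ler_pM2r ?invr_gt0//.
  by rewrite lerBlDr lerDl exprn_ge0.
elim: m => [|m IH].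
  rewrite addn0 subrr mul0r addr0 (le_trans (ler_sum _ (fun k _ => ba k)))//.
  by rewrite sumr_const_nat subn0 mulr_natl.
rewrite addnS big_nat_recr//= (le_trans (lerD IH (bq (n + m)%N)))//.
rewrite le_eqVlt; apply/orP; left; apply/eqP.
rewrite (exprS _ (n + m).+1); field.
by rewrite gt_eqF.
Qed.

Lemma ler_dist_Sp (R : realType) (p x y : R) (n : nat) : 0 < p -> p <= 1 ->
  `|Sp p x - Sp p y| <=
    n%:R * `|x - y| `^ p + (2^-1 `^ p) ^+ n.+1 / (1 - 2^-1 `^ p).
Proof.
move=> p0 p1.
have q1 : 0 <= (2^-1 : R) `^ p < 1.
  rewrite powR_ge0/= /powR invr_eq0 pnatr_eq0/= expR_lt1.
  by rewrite nmulr_llt0// ln_lt0//; lra.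
have cvg_dist : (`|(series (Sp_term p x) - series (Sp_term p y)) n|
    @[n --> \oo] --> `|Sp p x - Sp p y|)%classic.
  by apply: cvg_norm; apply: cvgB; exact: is_cvg_Sp.
apply: (cvgr_to_le cvg_dist).
(* To pass to the limit, it is enough to bound the partial sums with at least [n] terms. *)
exists n => //= m /= nm; rewrite -(subnKC nm).
rewrite fctE /series/= -sumrB.
apply: le_trans (ler_norm_sum _ _ _) _.
apply: sum_le_const_geometric => // k.
  exact: ler_dist_Sp_term_dist.
exact: ler_dist_Sp_term_geometric.
Qed.

Theorem theorem2 (R : realType) (p : R) (hp0 : 0 < p) (hp1 : p <= 1) :
  generalized_holder (Sp p) p
    (1 / p * log2 (p * ln 2 / (2 `^ p - 1)) + 2 `^ p / (p * ln 2) + 1).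
Proof.
move=> x y xy h2; have h0 : 0 < `|x - y| by rewrite normr_gt0 subr_eq0.
pose h : R := `|x - y|; rewrite -/h in h0 h2 *.
have l2 : 0 < ln 2 :> R by rewrite ln_gt0// ltr1n.
pose u := p * ln 2; pose E := expR u; pose L := log2 (1 / h).
have u0 : 0 < u by rewrite mulr_gt0.
have EE : 2 `^ p = E by rewrite /powR pnatr_eq0.
have E1 : 1 < E by rewrite expR_gt1.
have uE : 1 + u <= E by exact: expR_ge1Dx.
have EN0 : E != 0 by rewrite gt_eqF// (lt_trans ltr01).
have E1N0 : E - 1 != 0 by rewrite subr_eq0 gt_eqF.
have qE : 2^-1 `^ p = E^-1.
  by rewrite /powR invr_eq0 pnatr_eq0/= lnV ?posrE// mulrN expRN.
have hL : h `^ p = expR (- (u * L)).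
  rewrite /powR gt_eqF//= /L /log2 div1r lnV ?posrE//; congr expR.
  by rewrite /u; field; rewrite gt_eqF.
have L1 : 1 <= L.
  rewrite /L /log2 div1r ler_pdivlMr// mul1r ler_ln ?posrE ?invr_gt0//.
  by rewrite -[leLHS]invrK lef_pV2 ?posrE ?invr_gt0.
pose d := 1 / p * log2 (u / (E - 1)).
rewrite EE -/u -/L -/d.
have r0 : 0 < u / (E - 1) by rewrite divr_gt0// subr_gt0.
have expud : expR (u * d) = u / (E - 1).
  rewrite -[RHS]lnK ?posrE//; congr expR.
  by rewrite /d /log2 /u; field; rewrite !gt_eqF.
(* This makes L + d nonnegative, so its integer part is a natural number. *)
have d_ge : -1 <= d.
  rewrite -(ler_pM2l u0) mulrN1 -ler_expR expud expRN -/E.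
  (* The goal [E^-1 <= u / (E - 1)] amounts to [1 - E^-1 <= u]. *)
  have : 1 - u <= E^-1 by rewrite -expRN expR_ge1Dx.
  have Ei : E * E^-1 = 1 by rewrite divff.
  move=> H; rewrite ler_pdivlMr; last by lra.
  by rewrite mulrBr mulr1 mulrC Ei; lra.
have Eu : 1 <= E / u by rewrite ler_pdivlMr//; lra.
pose n := Num.truncn (L + d).
have Ld0 : 0 <= L + d by lra.
have /andP[nle nlt] := truncn_itv Ld0.
rewrite -/n -natr1 in nle nlt.
apply: le_trans (ler_dist_Sp _ _ x y n hp0 hp1) _.
rewrite qE -/h hL.
set H := expR (- (u * L)).
have H0 : 0 < H by exact: expR_gt0.
(* By [expud], the geometric tail evaluated at the real index [L + d] equals [H / u]. Since
   [L + d < n + 1], replacing this index by [n] costs at most one factor [E]. *)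
have tail : E^-1 ^+ n.+1 / (1 - E^-1) <= H * (E / u).
  have -> : E^-1 ^+ n.+1 / (1 - E^-1) = E^-1 ^+ n / (E - 1).
    rewrite exprS -mulrA mulrCA; congr (_ * _).
    by rewrite -invfM mulrBr mulr1 divff.
  have -> : H * (E / u) = expR (u * (1 - (L + d))) / (E - 1).
    rewrite (_ : u * _ = u + (- (u * L) - u * d)); last by ring.
    rewrite !expRD -/H -/E expRN expud invf_div !mulrA.
    by rewrite [RHS]mulrAC mulfK// (mulrC E).
  rewrite ler_pM2r ?invr_gt0 ?subr_gt0//.
  rewrite -expRN -expRM_natl ler_expR mulrN mulrC -mulrN ler_pM2l//.
  by lra.
apply: le_trans (lerD (lexx _) tail) _.
rewrite (mulrC n%:R) -mulrDr (mulrC _ H) -mulrA ler_pM2l//.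
(* After [n <= L + d], it remains to multiply the nonnegative [d + E / u] by [L >= 1]. *)
apply: (@le_trans _ _ (L + (d + E / u))); first by rewrite addrA lerD2r.
rewrite (mulrDl _ 1) mul1r [leRHS]addrC lerD2l ler_peMr//.
by rewrite -(addNr 1) lerD.
Qed.
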